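(* Let $\mathfrak{g}$ be a two-step nilpotent Lie group with the Campbell-Hausdorff multiplication $x\circ y=x+y+\frac12[x,y]$, of dimension $d$. If $A,B$ are $\mathcal{S}$-convolvers on $\mathfrak{g}$, then for every multiindex $\alpha\in\mathbb{N}^d$, $$T^{\alpha}(A*B)=\sum_{\beta+\gamma+\sigma_{[0]}=\alpha}\binom{\alpha}{\beta}_{\sigma}\,c_{\sigma}\;T^{\beta+\sigma_{[1]}}A*T^{\gamma+\sigma_{[2]}}B,$$ where the sum runs over all $\beta,\gamma\in\mathbb{N}^d$ and $\sigma\in\mathbb{N}^D$ with $\beta+\gamma+\sigma_{[0]}=\alpha$.
   Context: $\mathbb{N}$ contains $0$. $\mathfrak{g}$ is a real two-step nilpotent Lie algebra of dimension $d$, endowed with dilations $(\delta_t)_{t>0}$ (one-parameter group of automorphisms) with exponents of homogeneity $1,2$, i.e. $\mathfrak{g}=\mathfrak{g}_1\oplus\mathfrak{g}_2$ with $\mathfrak{g}_j=\{x:\delta_t(x)=t^jx \text{ for all } t>0\}$. The vector space $\mathfrak{g}$ is also a Lie group with multiplication $x\circ y=x+y+\frac12[x,y]$ (so $y^{-1}=-y$). Fix a basis $X_1,\dots,X_d$ of $\mathfrak{g}$, write $x=\sum_i x_iX_i$, and define structure constants by $[X_i,X_j]=\sum_{k=1}^d a_{i,j,k}X_k$. A (normalized) Lebesgue measure $dx$ on $\mathfrak{g}$ is a Haar measure, and the convolution of functions is $f*g(x)=\int_{\mathfrak{g}}f(x\circ y^{-1})g(y)\,dy$. For a multiindex $\alpha$,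 $T^\alpha f(x)=x_1^{\alpha_1}\cdots x_d^{\alpha_d}f(x)$, and for a tempered distribution $A$, $\langle T^\alpha A,f\rangle=\langle A,T^\alpha f\rangle$. Let $D=\{(i,j,k):a_{i,j,k}\neq0\}$. For $\sigma\in\mathbb{N}^D$ the multiindices $\sigma_{[0]},\sigma_{[1]},\sigma_{[2]}\in\mathbb{N}^d$ are $\sigma_{[0],k}=\sum_{i,j}\sigma_{(i,j,k)}$, $\sigma_{[1],i}=\sum_{j,k}\sigma_{(i,j,k)}$, $\sigma_{[2],j}=\sum_{i,k}\sigma_{(i,j,k)}$ (sums over triples in $D$). For $\beta+\sigma_{[0]}\le\alpha$, $\binom{\alpha}{\beta}_\sigma=\frac{\alpha!}{\beta!\,\sigma!\,(\alpha-\beta-\sigma_{[0]})!}$, where factorials of multiindices are products of the factorials of their entries, and $c_\sigma=2^{-\sum_{(i,j,k)\in D}\sigma_{(i,j,k)}}\prod_{(i,j,k)\in D}a_{i,j,k}^{\sigma_{(i,j,k)}}$. $\mathcal{S}$-convolvers: $\mathcal{S}(\mathfrak{g})$ is the Schwartz space and $\mathcal{S}'(\mathfrak{g})$ its dual (tempered distributions). For $A\in\mathcal{S}'(\mathfrak{g})$ and $f\in\mathcal{S}(\mathfrak{g})$, $f*A(x)=\langle A,\widetilde f_x\rangle$ with $\widetilde f_x(y)=f(x\circ y^{-1})$, and similarly $A*f(x)=\langle A,\,y\mapsto f(y^{-1}\circ x)\rangle$. $A$ is a right (left) $\mathcal{S}$-convolver if $f*A\in\mathcal{S}(\mathfrak{g})$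 ($A*f\in\mathcal{S}(\mathfrak{g})$) for every $f\in\mathcal{S}(\mathfrak{g})$; $A$ is an $\mathcal{S}$-convolver if it is both. With $\widetilde f(x)=f(x^{-1})$ and $\langle\widetilde A,f\rangle=\langle A,\widetilde f\rangle$, the convolution of $\mathcal{S}$-convolvers $A,B$ is the tempered distribution given by $\langle A*B,f\rangle=\langle B,\widetilde A*f\rangle$; it satisfies $f*(A*B)=(f*A)*B$. The space of $\mathcal{S}$-convolvers is closed under convolution and under multiplication by polynomials (a known result of Corwin). *)

(* Defs.v *)
From HB Require Import structures.
From mathcomp Require Import all_boot all_order all_algebra.
From mathcomp Require Import all_classical all_reals all_analysis.
From mathcomp Require Import complex.

Set Implicit Arguments.
Unset Strict Implicit.
Unset Printing Implicit Defensive.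

Import Order.TTheory GRing.Theory Num.Theory.
Import numFieldNormedType.Exports.

Local Open Scope classical_set_scope.
Local Open Scope ring_scope.
Local Open Scope complex_scope.

Section LieAlgebra.
Variables (R : realType) (g : vectType R).

Definition is_lie_bracket (br : g -> g -> g) : Prop :=
  [/\ forall z, linear (br z), forall z, linear (br^~ z),
      forall x, br x x = 0
    & forall x y z, br x (br y z) + br y (br z x) + br z (br x y) = 0].

(* Nilpotency of class at most two, so abelian algebras are not excluded. *)
Definition two_step (br : g -> g -> g) : Prop :=
  forall x y z, br x (br y z) = 0.

(* The values of [delta] at nonpositive parameters are irrelevant. *)
Definition is_dilation_group (br : g -> g -> g) (delta : R -> g -> g) : Prop :=
  (forall t, 0 < t ->
     [/\ linear (delta t), bijective (delta t)
       & forall x y, delta t (br x y) = br (delta t x) (delta t y)]) /\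
  (forall s t x, 0 < s -> 0 < t -> delta (s * t) x = delta s (delta t x)).

Definition exponents_one_two (delta : R -> g -> g) : Prop :=
  exists g1 g2 : {vspace g},
    [/\ forall x, x \in g1 <-> (forall t, 0 < t -> delta t x = t *: x),
        forall x, x \in g2 <-> (forall t, 0 < t -> delta t x = t ^+ 2 *: x),
        (g1 + g2)%VS = fullv
      & directv (g1 + g2)].

Definition gmul (br : g -> g -> g) (x y : g) : g := x + y + 2^-1 *: br x y.

Definition ginv (x : g) : g := - x.

End LieAlgebra.

Notation multiindex d := {ffun 'I_d -> nat}.

Section SchwartzSpace.
Variables (R : realType) (d : nat).

Definition monomial (alpha : multiindex d) (v : 'rV[R]_d) : R :=
  \prod_(i < d) v 0 i ^+ alpha i.

Definition iter_partial (s : seq 'I_d) (F : 'rV[R]_d -> R) : 'rV[R]_d -> R :=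
  foldr (fun i G v => 'D_(delta_mx 0 i) G v) F s.

Definition smooth (F : 'rV[R]_d -> R) : Prop :=
  forall s : seq 'I_d, continuous (iter_partial s F) /\
    forall (i : 'I_d) v, derivable (iter_partial s F) v (delta_mx 0 i).

Definition iter_partialC (s : seq 'I_d) (F : 'rV[R]_d -> R[i])
    (v : 'rV[R]_d) : R[i] :=
  iter_partial s (fun w => complex.Re (F w)) v +i*
  iter_partial s (fun w => complex.Im (F w)) v.

Definition smoothC (F : 'rV[R]_d -> R[i]) : Prop :=
  smooth (fun w => complex.Re (F w)) /\ smooth (fun w => complex.Im (F w)).

(* The modulus in [R[i]] is [R[i]]-valued with zero imaginary part, whence the
   outer [Re]. Derivatives are indexed by words in the coordinates rather than
   by multiindices; on smooth functions the two families coincide. *)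
Definition seminorm (alpha : multiindex d) (s : seq 'I_d)
    (F : 'rV[R]_d -> R[i]) : \bar R :=
  ereal_sup (range (fun v =>
    (complex.Re `|(monomial alpha v)%:C * iter_partialC s F v|)%:E)).

End SchwartzSpace.

Section Distributions.
Variables (R : realType) (g : vectType R) (d : nat) (X : d.-tuple g).

Definition of_coords (v : 'rV[R]_d) : g := \sum_(i < d) v 0 i *: X`_i.

Definition seminorm_g (alpha : multiindex d) (s : seq 'I_d) (f : g -> R[i]) :=
  seminorm alpha s (fun v => f (of_coords v)).

Definition schwartz (f : g -> R[i]) : Prop :=
  smoothC (fun v => f (of_coords v)) /\
  forall alpha s, (seminorm_g alpha s f < +oo)%E.

(* Distributions are functionals on all functions [g -> R[i]], of which only
   the values on Schwartz functions are meaningful; see [dist_eq]. The last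
   clause is continuity for the topology generated by the seminorms. *)
Definition tempered (A : (g -> R[i]) -> R[i]) : Prop :=
  (forall (c : R[i]) f h, schwartz f -> schwartz h ->
     A (fun x => c * f x + h x) = c * A f + A h) /\
  (forall f, schwartz f -> forall e : R, 0 < e ->
     exists (L : seq (multiindex d * seq 'I_d)) (eta : R), 0 < eta /\
       forall h, schwartz h ->
         (forall p, p \in L ->
            (seminorm_g p.1 p.2 (fun x => (h x - f x)%R) < eta%:E)%E) ->
         `|A h - A f| < e%:C).

Definition dist_eq (A B : (g -> R[i]) -> R[i]) : Prop :=
  forall f, schwartz f -> A f = B f.

Definition Tfun (alpha : multiindex d) (f : g -> R[i]) : g -> R[i] :=
  fun x => (\prod_(i < d) coord X i x ^+ alpha i)%:C * f x.

Definition Tdist (alpha : multiindex d) (A : (g -> R[i]) -> R[i]) :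
    (g -> R[i]) -> R[i] :=
  fun f => A (Tfun alpha f).

End Distributions.

Section Convolution.
Variables (R : realType) (g : vectType R) (br : g -> g -> g).

Definition fun_conv_dist (f : g -> R[i]) (A : (g -> R[i]) -> R[i]) :
    g -> R[i] :=
  fun x => A (fun y => f (gmul br x (ginv y))).

Definition dist_conv_fun (A : (g -> R[i]) -> R[i]) (f : g -> R[i]) :
    g -> R[i] :=
  fun x => A (fun y => f (gmul br (ginv y) x)).

Definition dist_tilde (A : (g -> R[i]) -> R[i]) : (g -> R[i]) -> R[i] :=
  fun f => A (fun x => f (ginv x)).

Definition dist_conv (A B : (g -> R[i]) -> R[i]) : (g -> R[i]) -> R[i] :=
  fun f => B (dist_conv_fun (dist_tilde A) f).

Variables (d : nat) (X : d.-tuple g).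

Definition right_convolver (A : (g -> R[i]) -> R[i]) : Prop :=
  forall f, schwartz X f -> schwartz X (fun_conv_dist f A).

Definition left_convolver (A : (g -> R[i]) -> R[i]) : Prop :=
  forall f, schwartz X f -> schwartz X (dist_conv_fun A f).

Definition convolver (A : (g -> R[i]) -> R[i]) : Prop :=
  [/\ tempered X A, right_convolver A & left_convolver A].

End Convolution.

Section StructureConstants.
Variables (R : realType) (g : vectType R) (br : g -> g -> g).
Variables (d : nat) (X : d.-tuple g).

Definition structure_const (i j k : 'I_d) : R := coord X k (br X`_i X`_j).

Definition Dset : {set 'I_d * 'I_d * 'I_d} :=
  finset (fun t => structure_const t.1.1 t.1.2 t.2 != 0).

Notation Dmultiindex := {ffun {t | t \in Dset} -> nat}.

Definition sigma0 (sigma : Dmultiindex) : multiindex d :=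
  [ffun k => (\sum_(t : {t | t \in Dset} | (val t).2 == k) sigma t)%N].

Definition sigma1 (sigma : Dmultiindex) : multiindex d :=
  [ffun i => (\sum_(t : {t | t \in Dset} | (val t).1.1 == i) sigma t)%N].

Definition sigma2 (sigma : Dmultiindex) : multiindex d :=
  [ffun j => (\sum_(t : {t | t \in Dset} | (val t).1.2 == j) sigma t)%N].

Definition mfact (I : finType) (a : {ffun I -> nat}) : nat :=
  (\prod_(i : I) (a i)`!)%N.

(* Meant for [beta + sigma0 sigma <= alpha]; the subtraction is truncated. *)
Definition mbinom (alpha beta : multiindex d) (sigma : Dmultiindex) : R :=
  (mfact alpha)%:R /
  (mfact beta * mfact sigma *
   mfact [ffun i => alpha i - beta i - sigma0 sigma i])%N%:R.

Definition csigma (sigma : Dmultiindex) : R :=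
  2 ^- (\sum_(t : {t | t \in Dset}) sigma t)%N *
  \prod_(t : {t | t \in Dset})
    structure_const (val t).1.1 (val t).1.2 (val t).2 ^+ sigma t.

Definition index_set (alpha : multiindex d) :
    set (multiindex d * multiindex d * Dmultiindex) :=
  [set p | p.1.1 + p.1.2 + sigma0 p.2 = alpha].

(* Hence the finitely supported sum over [index_set alpha] is a genuine sum. *)
Lemma finite_index_set (alpha : multiindex d) : finite_set (index_set alpha).
Proof.
pose N := (\sum_(i < d) alpha i)%N.
pose T : finType := ({ffun 'I_d -> 'I_N.+1} * {ffun 'I_d -> 'I_N.+1} *
  {ffun {t | t \in Dset} -> 'I_N.+1})%type.
pose F (q : T) : multiindex d * multiindex d * Dmultiindex :=
  ([ffun i => val (q.1.1 i)], [ffun i => val (q.1.2 i)],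
   [ffun t => val (q.2 t)]).
apply: (@sub_finite_set _ _ (F @` setT)); last first.
  by apply: finite_image; exact: finite_finset.
move=> [[b c] s] /= /ffunP E.
have leN k : (b k + c k + sigma0 s k <= N)%N.
  have -> : (b k + c k + sigma0 s k = alpha k)%N by have := E k; rewrite !ffunE.
  by rewrite /N (bigD1 k) //= leq_addr.
have sN t : (s t <= N)%N.
  apply: leq_trans (leN (val t).2); rewrite ffunE (bigD1 t) //=.
  by rewrite addnCA leq_addr.
exists ([ffun i => inord (b i)], [ffun i => inord (c i)],
        [ffun t => inord (s t)]) => //.
rewrite /F /=; congr (_, _, _); apply/ffunP => i; rewrite !ffunE inordK // ltnS.
- by apply: leq_trans (leN i); rewrite -addnA leq_addr.
- by apply: leq_trans (leN i); rewrite -addnA addnCA leq_addr.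
- exact: sN.
Qed.

End StructureConstants.

Arguments index_set {R g} br {d} X alpha.

(* Main.v *)
Require Import Defs.
From HB Require Import structures.
From mathcomp Require Import all_boot all_order all_algebra.
From mathcomp Require Import all_classical all_reals all_analysis.
From mathcomp Require Import complex finmap.
From mathcomp Require Import ring.

Import Order.TTheory GRing.Theory Num.Theory.
Import numFieldNormedType.Exports.

Local Open Scope classical_set_scope.
Local Open Scope ring_scope.
Local Open Scope complex_scope.

(** Write [y x] for the group product.  By definition
    [<A * B, f> = B_x (A_y (f (y x)))], so the left-hand side of the formula is
    [B_x (A_y ((y x)^alpha f (y x)))].  The [k]-th coordinate of [y x] is
    [y_k + x_k] plus the sum of [2^-1 a_(i,j,k) y_i x_j] over the triples
    [(i, j, k)] in [D], hence the multinomial theorem ([multinomial],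
    [monomial_gmul]) expands [(y x)^alpha] into the monomials
    [y^(beta + sigma1) x^(gamma + sigma2)] with exactly the announced
    coefficients.  It remains to move the finite sum and the powers of [x] out
    of [A], and then the sum out of [B].

    A distribution is known to be additive only on Schwartz functions, so two
    facts carry the proof.
    - For fixed [x] the function [y |-> y^b f (y x)] is Schwartz
      ([schwartz_right_translation], [schwartz_Tfun]).  Right translations are
      affine maps because the bracket is bilinear, and affine changes of
      variables preserve Schwartz functions ([schwartz_affine]); the chain rule
      behind this needs that continuous partial derivatives determine all
      directional derivatives ([is_derive_partials]).
    - The function [x |-> A_y (y^b f (y x))] is Schwartz
      ([schwartz_tilde_conv]); this is the part of Corwin's theorem on
      multiplication of convolvers by polynomials that is needed here.  For
      [b = 0] it is the convolver property of [A] seen through inversion.  The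
      general case is by induction on [b], since [y = (y x) x^-1] writes
      [y_i f (y x)] as a combination of functions [h (y x)], [h] Schwartz, with
      coefficients [1] and [x_k] ([coord_mul_right_translation]).

    Stability of Schwartz functions under linear combinations, multiplication by
    a coordinate and affine changes of variables is shown by coinduction
    ([schwartzR_coind]): one exhibits a class of continuous rapidly decreasing
    functions that is stable under the partial derivatives. *)

(** * Directional derivatives *)

Section DirectionalDerivatives.
Set Implicit Arguments.
Unset Strict Implicit.
Variables (R : realType) (V : normedModType R).
Implicit Types (F : V -> R) (a u e p : V).

Lemma is_derive_line F e p (s : R) : derivable F (p + s *: e) e ->
  is_derive s 1 (fun h : R => F (p + h *: e)) ('D_e F (p + s *: e)).
Proof.
move=> dF.
have E : (fun h : R => h^-1 *: (((fun h => F (p + h *: e)) \o shift s) (h *: 1)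
            - F (p + s *: e))) =
         (fun h : R => h^-1 *: ((F \o shift (p + s *: e)) (h *: e)
            - F (p + s *: e))).
  apply/funext => h /=; congr (_ *: (F _ - _)).
  by rewrite [h *: 1]mulr1 scalerDl addrCA.
by split; rewrite /derivable /derive E.
Qed.

(** The point of the segment is recorded only through [|th| <= |r|], which is
    all that a continuity argument uses and avoids ordering [0] and [r]. *)
Lemma MVT_line F e p (r : R) : (forall v, derivable F v e) ->
  exists2 th : R, `|th| <= `|r| & F (p + r *: e) - F p = r * 'D_e F (p + th *: e).
Proof.
move=> dF; pose f (h : R) : R := F (p + h *: e).
pose df (h : R) : R := 'D_e F (p + h *: e).
have f'E (x : R) : is_derive x (1 : R) f (df x) by exact: is_derive_line.
have cf (A : set R) : {within A, continuous f}.
  apply: continuous_subspaceT => x.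
  by apply/differentiable_continuous/derivable1_diffP; case: (f'E x).
have f0 : F p = f 0 by rewrite /f scale0r addr0.
have [r0|r0] := leP 0 r.
  have [c /itvP cI E] := MVT_segment r0 (fun x _ => f'E x) (cf _).
  exists c; first by rewrite !ger0_norm ?cI.
  by rewrite f0 -/(f r) E subr0 mulrC.
have [c /itvP cI E] := MVT_segment (ltW r0) (fun x _ => f'E x) (cf _).
exists c; first by rewrite !ler0_norm ?lerN2 ?cI// ltW.
by rewrite f0 -/(f r) -opprB E sub0r mulrN opprK mulrC.
Qed.

(** The difference quotient along [u + c e] is the one along [u] plus the
    increment from [a + h u] to [a + h u + h c e]; by the mean value theorem the
    latter is [h c] times a derivative along [e] at a point close to [a], so
    only [e] has to be a direction of continuous differentiability. *)
Lemma is_derive_dirD F u e a (c : R) : derivable F a u ->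
  (forall v, derivable F v e) -> {for a, continuous ('D_e F)} ->
  is_derive a (u + c *: e) F ('D_u F a + c * 'D_e F a).
Proof.
move=> dFu dFe cF.
pose q (h : R) := h^-1 * (F (a + h *: u + (h * c) *: e) - F (a + h *: u)).
have qcvg : q @ 0^' --> c * 'D_e F a.
  apply/cvgrPdist_lt => eps eps0.
  pose K := `|c| + 1; have K0 : 0 < K by rewrite ltr_wpDl.
  have /cvgrPdist_lt/(_ (eps / K)) := cF.
  rewrite divr_gt0// => /(_ isT) /nbhs_normP[dl /= dl0 near_a].
  pose M := `|u| + `|c| * `|e| + 1.
  have M0 : 0 < M by rewrite ltr_wpDl// addr_ge0// mulr_ge0.
  (* [M] bounds the distance to [a] of every point met by the increment
     at [h], divided by [|h|]; the added 1 only makes it positive *)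
  near=> h.
  have h0 : h != 0 by near: h; exact: nbhs_dnbhs_neq.
  have [th thle E] := MVT_line (a + h *: u) (h * c) dFe.
  rewrite /q E -mulrA mulKf// -mulrBr normrM.
  have -> : eps = K * (eps / K) by rewrite mulrCA divff ?mulr1// gt_eqF.
  apply: (@le_lt_trans _ _ (K * `|'D_e F a - 'D_e F (a + h *: u + th *: e)|)).
    by rewrite ler_wpM2r// ler_wpDr.
  rewrite ltr_pM2l//; apply: near_a; rewrite /= -addrA opprD addNKr normrN.
  apply: (@le_lt_trans _ _ (`|h| * M)).
    apply: (le_trans (ler_normD _ _)); rewrite !normrZ /M !mulrDr.
    rewrite ler_wpDr ?mulr1// lerD2l mulrA ler_wpM2r//.
    by rewrite -normrM.
  rewrite -ltr_pdivlMr//; near: h; apply: dnbhs0_lt; exact: divr_gt0.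
have cv : (fun h : R => h^-1 *: ((F \o shift a) (h *: (u + c *: e)) - F a)) @ 0^'
    --> 'D_u F a + c * 'D_e F a.
  have -> : (fun h : R => h^-1 *: ((F \o shift a) (h *: (u + c *: e)) - F a)) =
      (fun h : R => h^-1 *: ((F \o shift a) (h *: u) - F a)) + q.
    apply/funext => h; rewrite /q /= fctE.
    rewrite -[h^-1 * _]/(h^-1 *: _) -scalerDr; congr (_ *: _).
    rewrite scalerDr scalerA [_ + a]addrC [h *: u + a]addrC addrA.
    by rewrite [RHS]addrC addrA subrK.
  by apply: cvgD; [exact: dFu|exact: qcvg].
by split; [apply/cvg_ex; eexists; exact: cv|exact: cvg_lim cv].
Unshelve. all: by end_near. Qed.

End DirectionalDerivatives.

(** * Multiindices *)

Definition unit_index (I : finType) (i : I) : {ffun I -> nat} :=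
  [ffun j => (i == j) : nat].
Arguments unit_index {I} i.

Lemma ffun_addI (J : finType) (s : {ffun J -> nat}) : injective (+%R s).
Proof.
move=> t u /ffunP E; apply/ffunP => j; have := E j; rewrite !ffunE.
exact: addnI.
Qed.

Lemma multiindex_ind (d : nat) (P : multiindex d -> Prop) : P 0 ->
  (forall i alpha, P alpha -> P (unit_index i + alpha)) -> forall alpha, P alpha.
Proof.
move=> P0 PS alpha; have [n] := ubnP (\sum_i alpha i)%N.
elim: n => // n IH in alpha * => le_n.
have [i ai|a0] := pickP (fun i => alpha i != 0%N); last first.
  suff -> : alpha = 0 by [].
  by apply/ffunP => i; rewrite ffunE; apply/eqP; move: (a0 i) => /negbFE.
pose alpha' : multiindex d := [ffun j => (alpha j - (i == j))%N].
have E : alpha = unit_index i + alpha'.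
  apply/ffunP => j; rewrite !ffunE [(_ + _)%R]subnKC//.
  by case: eqP => // <-; rewrite lt0n.
rewrite E; apply/PS/IH; rewrite -ltnS (leq_trans _ le_n)// ltnS.
rewrite (bigD1 i)//= [X in (_ < X)%N](bigD1 i)//= !ffunE eqxx subn1.
rewrite -addSn prednK ?lt0n// leq_add2l leq_sum// => j ji.
by rewrite ffunE leq_subr.
Qed.

(** * Schwartz functions of several real variables *)

Section RealSchwartz.
Set Implicit Arguments.
Unset Strict Implicit.
Variables (R : realType) (d : nat).
Local Notation rV := 'rV[R]_d.
Local Notation ee i := (delta_mx (0 : 'I_1) i : rV).
Implicit Types (F G : rV -> R) (i j : 'I_d) (v : rV).

Lemma continuous_muladd (T : topologicalType) (h f g : T -> R) :
  continuous h -> continuous f -> continuous g ->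
  continuous (fun x => h x * f x + g x).
Proof.
move=> ch cf cg x.
exact: (@cvgD R R T _ _ _ _ _ _ (cvgM (ch x) (cf x)) (cg x)).
Qed.

Definition rapid F :=
  forall alpha, exists M : R, forall v, `|monomial alpha v * F v| <= M.

Definition schwartzR F := smooth F /\ forall s, rapid (iter_partial s F).

(** Being Schwartz quantifies over words of derivatives; this principle replaces
    the word by its first letter, at the price of choosing a class [C] that is
    stable under derivation. *)
Lemma schwartzR_coind (C : set (rV -> R)) :
  (forall F, C F -> [/\ continuous F, rapid F &
     forall i, (forall v, derivable F v (ee i)) /\ C ('D_(ee i) F)]) ->
  forall F, C F -> schwartzR F.
Proof.
move=> CP F CF.
have Cs s : C (iter_partial s F).
  by elim: s => //= i s /CP[_ _ /(_ i)[]].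
split=> s; last by case: (CP _ (Cs s)).
have [ct _ Di] := CP _ (Cs s).
by split=> // i v; case: (Di i) => + _; apply.
Qed.

Lemma schwartzR_continuous F : schwartzR F -> continuous F.
Proof. by move=> [/(_ [::])[]]. Qed.

Lemma schwartzR_derivable F i v : schwartzR F -> derivable F v (ee i).
Proof. by move=> [/(_ [::])[_]] + _; apply. Qed.

Lemma schwartzR_rapid F : schwartzR F -> rapid F.
Proof. by move=> [_ /(_ [::])]. Qed.

Lemma schwartzR_partial F i : schwartzR F -> schwartzR ('D_(ee i) F).
Proof.
move=> [sF rF]; have E s : iter_partial s ('D_(ee i) F) = iter_partial (rcons s i) F.
  by rewrite /iter_partial foldr_rcons.
by split=> s; rewrite E.
Qed.

Lemma schwartzR_lin (a : R) F G : schwartzR F -> schwartzR G ->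
  schwartzR (fun v => a * F v + G v).
Proof.
move=> sF sG.
apply: (@schwartzR_coind
  [set H | exists F G, [/\ schwartzR F, schwartzR G &
                           H = fun v => a * F v + G v]]); last by exists F, G.
move=> {F G sF sG} _ [F [G [sF sG ->]]]; split.
- apply: continuous_muladd; [exact: cst_continuous| |]; exact: schwartzR_continuous.
- move=> alpha; have [M MP] := schwartzR_rapid sF alpha.
  have [N NP] := schwartzR_rapid sG alpha; exists (`|a| * M + N) => v.
  rewrite mulrDr mulrCA (le_trans (ler_normD _ _))// lerD// normrM.
  by rewrite ler_wpM2l.
- move=> i.
  have dH v : is_derive v (ee i) (fun v => a * F v + G v)
      (a * 'D_(ee i) F v + 'D_(ee i) G v).
    have dF := derivableP (@schwartzR_derivable _ i v sF).
    have dG := derivableP (@schwartzR_derivable _ i v sG).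
    exact: (is_deriveD (is_deriveZ a dF) dG).
  split=> [v|]; first by case: (dH v).
  exists ('D_(ee i) F), ('D_(ee i) G).
  split; [exact: schwartzR_partial|exact: schwartzR_partial|].
  by apply/funext => v; have /@derive_val := dH v.
Qed.

Lemma schwartzR0 : schwartzR (fun=> 0).
Proof.
apply: (@schwartzR_coind [set fun=> 0]) => // _ -> ; split.
- exact: cst_continuous.
- by move=> alpha; exists 0 => v; rewrite mulr0 normr0.
- by move=> i; split=> [v|]; [exact: derivable_cst|apply/funext => v; exact: derive_cst].
Qed.

Lemma schwartzR_sum (I : Type) (r : seq I) (c : I -> R) (F : I -> rV -> R) :
  (forall k, schwartzR (F k)) ->
  schwartzR (fun v => \sum_(k <- r) c k * F k v).
Proof.
move=> sF; elim: r => [|k r IH].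
  rewrite (_ : (fun=> _) = fun=> 0); first exact: schwartzR0.
  by apply/funext => v; rewrite big_nil.
rewrite (_ : (fun=> _) = fun v => c k * F k v + \sum_(k <- r) c k * F k v).
  exact: schwartzR_lin.
by apply/funext => v; rewrite big_cons.
Qed.

Lemma monomial_unit_index i (alpha : multiindex d) v :
  monomial (unit_index i + alpha) v = v 0 i * monomial alpha v.
Proof.
rewrite /monomial (bigD1 i)//= [in RHS](bigD1 i)//= !ffunE eqxx.
rewrite [(_ + _)%R]add1n exprS -mulrA; do 2!congr (_ * _).
by apply: eq_bigr => j ji; rewrite !ffunE eq_sym (negbTE ji).
Qed.

(** A derivative of [v_i F] is [v_i F' + F] or [v_i F'], so the class to use is
    that of all [v_i F + G]. *)
Lemma schwartzR_coord i F : schwartzR F -> schwartzR (fun v => v 0 i * F v).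
Proof.
move=> sF.
apply: (@schwartzR_coind
  [set H | exists F G, [/\ schwartzR F, schwartzR G &
                           H = fun v => v 0 i * F v + G v]]); last first.
  exists F, (fun=> 0); split=> //; first exact: schwartzR0.
  by apply/funext => v; rewrite addr0.
move=> {F sF} _ [F [G [sF sG ->]]]; split.
- apply: continuous_muladd; [exact: coord_continuous| |]; exact: schwartzR_continuous.
- move=> alpha; have [M MP] := schwartzR_rapid sF (unit_index i + alpha).
  have [N NP] := schwartzR_rapid sG alpha; exists (M + N) => v.
  rewrite mulrDr mulrA [_ * v 0 i]mulrC -monomial_unit_index.
  by rewrite (le_trans (ler_normD _ _))// lerD.
- move=> j.
  have dH v : is_derive v (ee j) (fun v => v 0 i * F v + G v)
      (v 0 i * 'D_(ee j) F v + ((i == j)%:R * F v + 'D_(ee j) G v)).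
    have dF := derivableP (@schwartzR_derivable _ j v sF).
    have dG := derivableP (@schwartzR_derivable _ j v sG).
    have dx : is_derive v (ee j) (fun v : rV => v 0 i) (i == j)%:R.
      have dfx := differentiable_coord v 0 i.
      split; first exact: diff_derivable.
      have := @derive_id _ rV v (ee j); rewrite derive_mx; last exact: derivable_id.
      by move=> /matrixP/(_ 0 i); rewrite !mxE eqxx.
    apply: is_derive_eq (is_deriveD (is_deriveM dx dF) dG) _.
    by rewrite addrA [F v *: _]mulrC.
  split=> [v|]; first by case: (dH v).
  exists ('D_(ee j) F), (fun v => (i == j)%:R * F v + 'D_(ee j) G v).
  split; first exact: schwartzR_partial.
    by apply: schwartzR_lin => //; exact: schwartzR_partial.
  by apply/funext => v; have /@derive_val := dH v.
Qed.

(** The coordinates of [u] are added one at a time with [is_derive_dirD]; this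
    gives the chain rule for affine maps without total differentiability. *)
Lemma is_derive_partials F (u a : rV) :
  (forall i, continuous ('D_(ee i) F)) ->
  (forall i v, derivable F v (ee i)) ->
  is_derive a u F (\sum_i u 0 i * 'D_(ee i) F a).
Proof.
move=> cF dF; rewrite [X in is_derive _ X _ _]row_sum_delta.
elim: (index_enum _) => [|i r IH].
  by rewrite !big_nil; exact: is_derive0.
rewrite !big_cons [X in is_derive _ X _ _]addrC [X in is_derive _ _ _ X]addrC.
rewrite -(@derive_val _ _ _ _ _ _ _ IH); apply: is_derive_dirD => //.
exact: cF.
Qed.

Lemma monomial0 v : monomial (0 : multiindex d) v = 1.
Proof. by rewrite /monomial big1// => i _; rewrite ffunE expr0. Qed.

Lemma continuous_affine (M : 'M[R]_d) (c : rV) :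
  continuous (fun v => v *m M + c).
Proof.
have -> : (fun v => v *m M + c) = fun v => \sum_i v 0 i *: row i M + c.
  by apply/funext => v; rewrite mulmx_sum_row.
elim: (index_enum _) => [|i r IH] v.
  by rewrite (_ : (fun=> _) = fun=> c);
    [exact: cst_continuous|apply/funext => w; rewrite big_nil add0r].
rewrite (_ : (fun=> _) = fun w : rV => w 0 i *: row i M +
    (\sum_(i <- r) w 0 i *: row i M + c)).
  exact: (@cvgD R rV rV _ _ _ _ _ _
            (cvgZr_tmp (@coord_continuous R _ _ 0 i v)) (IH v)).
by apply/funext => w; rewrite big_cons addrA.
Qed.

(** The functions [F \o L] with [F] Schwartz are stable under partial
    derivatives by the chain rule.  They are also stable under multiplication by
    [v_i], which is an affine function of [L v] because [L] is invertible;
    rapid decrease thus reduces to boundedness. *)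
Lemma schwartzR_affine (L : rV -> rV) (M M' : 'M[R]_d) (c c' : rV) F :
  (forall v, L v = v *m M + c) -> (forall v, v = L v *m M' + c') ->
  schwartzR F -> schwartzR (F \o L).
Proof.
move=> LE L'E sF.
apply: (@schwartzR_coind [set F \o L | F in schwartzR]); last by exists F.
move=> {F sF} _ [F sF <-].
have Di i v : is_derive v (ee i) (F \o L)
    ((fun w => \sum_j M i j * 'D_(ee j) F w) (L v)).
  have EL : (fun h : R => h^-1 *: (((F \o L) \o shift v) (h *: ee i) - (F \o L) v)) =
            (fun h : R => h^-1 *: ((F \o shift (L v)) (h *: row i M) - F (L v))).
    apply/funext => h /=; congr (_ *: (F _ - _)).
    by rewrite !LE mulmxDl addrA -scalemxAl -rowE.
  have [D1 D2] : is_derive (L v) (row i M) F (\sum_j M i j * 'D_(ee j) F (L v)).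
    apply: is_derive_eq; first apply: is_derive_partials.
    - by move=> j; apply/schwartzR_continuous/schwartzR_partial.
    - by move=> j w; exact: schwartzR_derivable.
    - by apply: eq_bigr => j _; rewrite mxE.
  by split; [rewrite /derivable EL|rewrite /derive EL].
split.
- move=> v; apply: continuous_comp; last exact: schwartzR_continuous.
  by rewrite (funext LE); exact: continuous_affine.
- suff bounded alpha : forall G, schwartzR G ->
      exists K : R, forall v, `|monomial alpha v * G (L v)| <= K.
    by move=> alpha; exact: bounded.
  elim/multiindex_ind: alpha => [|i alpha IH] G sG.
    have [K KP] := schwartzR_rapid sG 0; exists K => v.
    by have := KP (L v); rewrite !monomial0.
  have sQG : schwartzR (fun w => c' 0 i * G w + \sum_j M' j i * (w 0 j * G w)).
    by apply: schwartzR_lin => //; apply: schwartzR_sum => j; exact: schwartzR_coord.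
  have [K KP] := IH _ sQG; exists K => v.
  suff -> : monomial (unit_index i + alpha) v * G (L v) =
      monomial alpha v * (c' 0 i * G (L v) + \sum_j M' j i * (L v 0 j * G (L v))).
    exact: KP.
  rewrite monomial_unit_index mulrAC mulrC; congr (_ * _).
  rewrite {1}(L'E v) !mxE mulrDl addrC mulr_suml; congr (_ + _).
  by apply: eq_bigr => j _; rewrite mulrAC mulrC.
- move=> i; split=> [v|]; first by case: (Di i v).
  exists (fun w => \sum_j M i j * 'D_(ee j) F w).
    by apply: schwartzR_sum => j; exact: schwartzR_partial.
  by apply/funext => v; have /@derive_val -> := Di i v.
Qed.

End RealSchwartz.

(** * Schwartz functions and distributions on a space with a basis *)

Section SchwartzOnG.
Set Implicit Arguments.
Unset Strict Implicit.
Variables (R : realType) (g : vectType R) (d : nat) (X : d.-tuple g).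
Hypothesis hX : basis_of fullv X.
Implicit Types (f h : g -> R[i]) (x y z : g).
Local Notation schwartz := (schwartz X).

Lemma ge_Re_normc (a b : R) : `|a| <= complex.Re `|a +i* b|.
Proof. by have := normc_ge_Re (a +i* b); rewrite lecE /= => /andP[]. Qed.

Lemma ge_Im_normc (a b : R) : `|b| <= complex.Re `|a +i* b|.
Proof. by rewrite normc_def /= -sqrtr_sqr ler_wsqrtr// lerDr sqr_ge0. Qed.

Lemma le_normc_add (a b : R) : complex.Re `|a +i* b| <= `|a| + `|b|.
Proof.
rewrite normc_def /= -[leRHS]ger0_norm ?addr_ge0// -sqrtr_sqr ler_wsqrtr//.
rewrite sqrrD !real_normK ?num_real// addrAC lerDl mulrn_wge0// mulr_ge0//.
Qed.

Lemma real_mul_complex (m a b : R) : m%:C * (a +i* b) = (m * a) +i* (m * b).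
Proof. by rewrite [LHS]/GRing.mul/= !mul0r subr0 addr0. Qed.

Lemma seminorm_lty (F : 'rV[R]_d -> R[i]) alpha s :
  ((seminorm alpha s F < +oo)%E <-> exists M : R, forall v,
    complex.Re `|(monomial alpha v)%:C * iter_partialC s F v| <= M).
Proof.
rewrite /seminorm.
pose N v := complex.Re `|(monomial alpha v)%:C * iter_partialC s F v|.
rewrite -[ereal_sup _]/(ereal_sup (range (fun v => (N v)%:E))); split=> [|[M MP]].
  have ub v : ((N v)%:E <= ereal_sup (range (fun v => (N v)%:E)))%E.
    by apply: ereal_sup_ubound; exists v.
  case: (ereal_sup _) ub => [M ub _| |ub _].
  - by exists M => v; have := ub v; rewrite lee_fin.
  - by move=> _; rewrite ltxx.
  - by have := ub 0; rewrite leeNy_eq.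
apply: (@le_lt_trans _ _ M%:E); last exact: ltry.
by apply: ub_ereal_sup => _ [v _ <-]; rewrite lee_fin; exact: MP.
Qed.

Lemma schwartzP f : schwartz f <->
  schwartzR (fun v => complex.Re (f (of_coords X v))) /\
  schwartzR (fun v => complex.Im (f (of_coords X v))).
Proof.
split=> [[[sRe sIm] fin]|[[sRe rRe] [sIm rIm]]].
  split; split=> // s alpha; have /seminorm_lty[M MP] := fin alpha s;
    exists M => v; apply: le_trans (MP v); rewrite real_mul_complex.
    exact: ge_Re_normc.
  exact: ge_Im_normc.
split=> // alpha s; apply/seminorm_lty.
have [M MP] := rRe s alpha; have [N NP] := rIm s alpha; exists (M + N) => v.
by rewrite real_mul_complex (le_trans (le_normc_add _ _))// lerD.
Qed.

Lemma schwartz_lin (c : R[i]) f h : schwartz f -> schwartz h ->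
  schwartz (fun x => c * f x + h x).
Proof.
move=> /schwartzP[fR fI] /schwartzP[hR hI]; apply/schwartzP.
case: c => a b; split.
  rewrite (_ : (fun=> _) = fun v => a * complex.Re (f (of_coords X v)) +
    (- b * complex.Im (f (of_coords X v)) + complex.Re (h (of_coords X v)))).
    by do 2!apply: schwartzR_lin => //.
  apply/funext => v; case: (f _) => p q; case: (h _) => r s /=.
  by rewrite mulNr addrA.
rewrite (_ : (fun=> _) = fun v => a * complex.Im (f (of_coords X v)) +
  (b * complex.Re (f (of_coords X v)) + complex.Im (h (of_coords X v)))).
  by do 2!apply: schwartzR_lin => //.
apply/funext => v; case: (f _) => p q; case: (h _) => r s /=.
by rewrite addrA.
Qed.

Lemma schwartz0 : schwartz (fun=> 0).
Proof. by apply/schwartzP; split; exact: schwartzR0. Qed.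

Lemma schwartz_sum (I : Type) (r : seq I) (c : I -> R[i]) (F : I -> g -> R[i]) :
  (forall k, schwartz (F k)) -> schwartz (fun x => \sum_(k <- r) c k * F k x).
Proof.
move=> sF; elim: r => [|k r IH].
  rewrite (_ : (fun=> _) = fun=> 0); first exact: schwartz0.
  by apply/funext => v; rewrite big_nil.
rewrite (_ : (fun=> _) = fun x => c k * F k x + \sum_(k <- r) c k * F k x).
  exact: schwartz_lin.
by apply/funext => v; rewrite big_cons.
Qed.

Definition coords x : 'rV[R]_d := \row_i coord X i x.

Lemma of_coordsK v : coords (of_coords X v) = v.
Proof.
apply/rowP => i; rewrite mxE /of_coords coord_sum_free//.
exact: basis_free hX.
Qed.

Lemma coordsK x : of_coords X (coords x) = x.
Proof.
rewrite [RHS](coord_basis hX (memvf x)).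
by apply: eq_bigr => i _; rewrite mxE.
Qed.

Lemma schwartz_coord i f : schwartz f ->
  schwartz (fun x => (coord X i x)%:C * f x).
Proof.
move=> /schwartzP[fR fI]; apply/schwartzP.
have E v : (coord X i (of_coords X v))%:C * f (of_coords X v) =
    (v 0 i * complex.Re (f (of_coords X v))) +i*
    (v 0 i * complex.Im (f (of_coords X v))).
  have -> : coord X i (of_coords X v) = v 0 i.
    by rewrite -[in RHS](of_coordsK v) mxE.
  by case: (f _) => a b; rewrite real_mul_complex.
by split; under eq_fun do rewrite E /=; exact: schwartzR_coord.
Qed.

Lemma Tfun_unit_index i (b : multiindex d) f :
  Tfun X (unit_index i + b) f = Tfun X b (fun x => (coord X i x)%:C * f x).
Proof.
apply/funext => x; rewrite /Tfun.
have := monomial_unit_index i b (coords x); rewrite /monomial.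
under eq_bigr do rewrite mxE; move=> ->; rewrite mxE rmorphM/=.
under eq_bigr do rewrite mxE.
by rewrite mulrCA mulrA.
Qed.

Lemma Tfun0 f : Tfun X 0 f = f.
Proof.
by apply/funext => x; rewrite /Tfun big1 ?mul1r// => i _; rewrite ffunE expr0.
Qed.

Lemma schwartz_Tfun (b : multiindex d) f : schwartz f -> schwartz (Tfun X b f).
Proof.
elim/multiindex_ind: b f => [|i b IH] f sf; first by rewrite Tfun0.
by rewrite Tfun_unit_index; apply/IH/schwartz_coord.
Qed.

Lemma schwartz_linear_form (l : g -> R) f : scalar l -> schwartz f ->
  schwartz (fun x => (l x)%:C * f x).
Proof.
move=> ll sf.
pose L : {linear g -> R^o} := HB.pack l (GRing.isLinear.Build _ _ _ _ l ll).
rewrite (_ : (fun=> _) = fun x => \sum_(j < d) (l X`_j)%:C * ((coord X j x)%:C * f x)).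
  by apply: schwartz_sum => j; exact: schwartz_coord.
apply/funext => x; rewrite {1}(coord_basis hX (memvf x)) -[l _]/(L _) linear_sum.
rewrite rmorph_sum mulr_suml; apply: eq_bigr => j _.
by rewrite linearZ /= rmorphM /= mulrCA mulrA.
Qed.

(** Inversion and right translations of a two-step group are the instances of
    interest. *)
Lemma schwartz_affine (phi psi l l' : g -> g) (c c' : g) f :
  linear l -> linear l' -> (forall x, phi x = l x + c) ->
  (forall x, psi x = l' x + c') -> cancel phi psi ->
  schwartz f -> schwartz (f \o phi).
Proof.
move=> ll ll' phiE psiE K /schwartzP[fR fI].
pose mx (k : g -> g) : 'M[R]_d := \matrix_(i, j) coord X j (k X`_i).
have mxP (k : g -> g) v : linear k -> v *m mx k = coords (k (of_coords X v)).
  move=> lk; pose L : {linear g -> g} := HB.pack k (GRing.isLinear.Build _ _ _ _ k lk).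
  apply/rowP => j; rewrite !mxE -[k _]/(L _) !linear_sum.
  by apply: eq_bigr => i _; rewrite mxE !linearZ.
pose co (k : g -> g) v := coords (k (of_coords X v)).
have co_affine (k m : g -> g) e v : linear m -> (forall x, k x = m x + e) ->
    co k v = v *m mx m + coords e.
  by move=> lm kE; rewrite mxP// /co kE; apply/rowP => j; rewrite !mxE linearD.
have co_inv v : v = co phi v *m mx l' + coords c'.
  by rewrite -(co_affine psi)// /co coordsK K of_coordsK.
apply/schwartzP; split.
  have := schwartzR_affine (fun v => co_affine _ _ _ v ll phiE) co_inv fR.
  by congr schwartzR; apply/funext => v; rewrite /= coordsK.
have := schwartzR_affine (fun v => co_affine _ _ _ v ll phiE) co_inv fI.
by congr schwartzR; apply/funext => v; rewrite /= coordsK.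
Qed.

Section Functional.
Variable A : (g -> R[i]) -> R[i].
Hypothesis hA : tempered X A.

Lemma tempered_lin (c : R[i]) f h : schwartz f -> schwartz h ->
  A (fun x => c * f x + h x) = c * A f + A h.
Proof. by case: hA => + _; apply. Qed.

Lemma tempered0 : A (fun=> 0) = 0.
Proof.
have := tempered_lin 1 schwartz0 schwartz0.
under eq_fun do rewrite mulr0 addr0.
by rewrite mul1r => /eqP; rewrite -subr_eq subrr => /eqP <-.
Qed.

Lemma tempered_sum (I : Type) (r : seq I) (c : I -> R[i]) (F : I -> g -> R[i]) :
  (forall k, schwartz (F k)) ->
  A (fun x => \sum_(k <- r) c k * F k x) = \sum_(k <- r) c k * A (F k).
Proof.
move=> sF; elim: r => [|k r IH].
  under eq_fun do rewrite big_nil.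
  by rewrite big_nil tempered0.
under eq_fun do rewrite big_cons.
rewrite tempered_lin//; last exact: schwartz_sum.
by rewrite IH big_cons.
Qed.

End Functional.

End SchwartzOnG.

(** * A multinomial theorem for grouped variables *)

Section MultinomialExpansion.
Set Implicit Arguments.
Unset Strict Implicit.
Variables (R : realType) (d : nat) (I : finType) (pi : I -> 'I_d) (z : I -> R).
Implicit Types (t : {ffun I -> nat}) (alpha : multiindex d).

(** The variables [z i] are sorted into groups by [pi]; [push t] is the vector of
    the degrees of the monomial [z^t] in each group. *)
Definition push t : multiindex d := [ffun k => (\sum_(i | pi i == k) t i)%N].

Definition fiber alpha : set {ffun I -> nat} := [set t | push t = alpha].

Definition egf_term t : R := \prod_i (z i ^+ t i / (t i)`!%:R).

Lemma finite_fiber alpha : finite_set (fiber alpha).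
Proof.
pose N := (\sum_(k < d) alpha k)%N.
pose F (q : {ffun I -> 'I_N.+1}) : {ffun I -> nat} := [ffun i => val (q i)].
apply: (@sub_finite_set _ _ (F @` setT)); last first.
  by apply: finite_image; exact: finite_finset.
move=> t /= /ffunP E.
have tN i : (t i <= N)%N.
  apply: (@leq_trans (alpha (pi i))); last by rewrite /N (bigD1 (pi i)) //= leq_addr.
  by rewrite -E ffunE (bigD1 i) //= leq_addr.
exists [ffun i => inord (t i)] => //.
by apply/ffunP => i; rewrite !ffunE /= inordK // ltnS.
Qed.

Lemma egf_term_unit_index i t :
  ((unit_index i + t)%R i)%:R * egf_term (unit_index i + t) = z i * egf_term t.
Proof.
rewrite /egf_term (bigD1 i)//= [in RHS](bigD1 i)//= !ffunE eqxx !mulrA.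
rewrite [(_ + _)%R]add1n; congr (_ * _); last first.
  by apply: eq_bigr => j ji; rewrite !ffunE eq_sym (negbTE ji).
rewrite exprS factS natrM invfM; have : (t i).+1%:R != 0 :> R by rewrite pnatr_eq0.
move=> n0; rewrite !mulrA [_ * z i]mulrC -!mulrA; congr (_ * _).
by rewrite mulrCA; congr (_ * _); rewrite mulrA divff// mul1r.
Qed.

Lemma push_unit_index i t : push (unit_index i + t) = unit_index (pi i) + push t.
Proof.
apply/ffunP => k; rewrite !ffunE.
under eq_bigr do rewrite ffunE.
rewrite big_split; congr (_ + _)%N; have [<-|ne] := eqVneq (pi i) k.
  rewrite (bigD1 i)//= ffunE eqxx big1// => j /andP[_ ji].
  by rewrite ffunE eq_sym (negbTE ji).
rewrite big1// => j /eqP jk; rewrite ffunE; case: eqP => // ij.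
by rewrite ij jk eqxx in ne.
Qed.

(** The coefficient of [s^alpha] in the exponential of the sum of all
    [s_(pi i) * z i]. *)
Definition egf alpha : R := \sum_(t \in fiber alpha) egf_term t.

(** The terms with [t i = 0] vanish, and in the others one factor [z i] cancels
    against the weight [t i] of the factorial. *)
Lemma egf_weighted i alpha :
  \sum_(t \in fiber (unit_index (pi i) + alpha)) ((t i)%:R * egf_term t) =
  z i * egf alpha.
Proof.
rewrite /egf mulr_fsumr.
under [RHS]eq_fsbigr do rewrite -egf_term_unit_index.
rewrite -(@fsbig_image _ _ _ _ _ (fiber alpha) (+%R (unit_index i))
  (fun t => (t i)%:R * egf_term t)); last by move=> s t _ _; exact: ffun_addI.
apply/esym/fsbig_widen => [_ [t ta <-]|t [ta nt]] /=.
  by rewrite /fiber /= push_unit_index ta.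
have [ti|ti] := posnP (t i); first by rewrite ti mul0r.
exfalso; apply: nt; exists ([ffun j => t j - (i == j)]%N).
  apply: (@ffun_addI _ (unit_index (pi i))); rewrite -ta -push_unit_index; congr push.
  by apply/ffunP => j; rewrite !ffunE [(_ + _)%R]subnKC//; case: eqP => // <-.
by apply/ffunP => j; rewrite !ffunE [(_ + _)%R]subnKC//; case: eqP => // <-.
Qed.

(** Euler's identity in the variables of group [k]: summing the weights [t i]
    over this group gives the constant degree. *)
Lemma egf_rec k alpha :
  ((unit_index k + alpha)%R k)%:R * egf (unit_index k + alpha) =
  (\sum_(i | pi i == k) z i) * egf alpha.
Proof.
rewrite mulr_suml.
pose E := fset_set (fiber (unit_index k + alpha)).
transitivity (\sum_(i | pi i == k) \sum_(t <- E) ((t i)%:R * egf_term t)); last first.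
  apply: eq_bigr => i /eqP ik; rewrite -egf_weighted ik fsbig_finite//.
  exact: finite_fiber.
rewrite exchange_big /egf mulr_fsumr fsbig_finite; last exact: finite_fiber.
apply: eq_big_seq => t; rewrite in_fset_set; last exact: finite_fiber.
by move=> /set_mem <-; rewrite -mulr_suml ffunE natr_sum.
Qed.

(** Both sides obey the recurrence of [egf_rec]; working with several groups at
    once avoids distributing a product of multinomial sums. *)
Lemma multinomial alpha :
  \prod_k (\sum_(i | pi i == k) z i) ^+ alpha k =
  (mfact alpha)%:R * \sum_(t \in fiber alpha) egf_term t.
Proof.
rewrite -/(egf alpha); elim/multiindex_ind: alpha => [|k alpha IH].
  rewrite big1 => [|k _]; last by rewrite ffunE expr0.
  rewrite /mfact big1 ?mul1r => [|k _]; last by rewrite ffunE.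
  rewrite /egf (_ : fiber 0 = [set 0]) ?fsbig_set1.
    by rewrite /egf_term big1// => i _; rewrite ffunE expr0 fact0 divr1.
  apply/seteqP; split=> [t /= /ffunP t0|t /= ->]; apply/ffunP => i.
    have := t0 (pi i); rewrite !ffunE (bigD1 i)//= => /eqP.
    by rewrite addn_eq0 => /andP[/eqP->].
  by rewrite !ffunE big1// => j _; rewrite ffunE.
have -> : \prod_j (\sum_(i | pi i == j) z i) ^+ (unit_index k + alpha)%R j =
    (\sum_(i | pi i == k) z i) * \prod_j (\sum_(i | pi i == j) z i) ^+ alpha j.
  rewrite (bigD1 k)//= [in RHS](bigD1 k)//= !ffunE eqxx [(_ + _)%R]add1n exprS.
  rewrite -mulrA; do 2!congr (_ * _).
  by apply: eq_bigr => j jk; rewrite !ffunE eq_sym (negbTE jk).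
rewrite IH mulrCA -egf_rec mulrA; congr (_ * _); rewrite -natrM; congr (_%:R).
rewrite /mfact (bigD1 k)//= [in RHS](bigD1 k)//= !ffunE eqxx [(_ + _)%R]add1n.
rewrite factS mulnC mulnA; congr (_ * _)%N.
by apply: eq_bigr => j jk; rewrite !ffunE eq_sym (negbTE jk).
Qed.

End MultinomialExpansion.

(** * Convolution on a two-step group *)

Section LieProduct.
Set Implicit Arguments.
Unset Strict Implicit.
Variables (R : realType) (g : vectType R) (br : g -> g -> g).
Variables (d : nat) (X : d.-tuple g).
Hypotheses (hbr : is_lie_bracket br) (hX : basis_of fullv X).
Implicit Types (x y z : g) (f h : g -> R[i]).
Local Notation schwartz := (schwartz X).
Local Notation gmul := (gmul br).
Local Notation structure_const := (structure_const br X).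

Fact bracket_linearl z : linear (br^~ z). Proof. by case: hbr. Qed.
Fact bracket_linearr z : linear (br z). Proof. by case: hbr. Qed.

Definition bracketl z : {linear g -> g} :=
  HB.pack (br^~ z) (GRing.isLinear.Build _ _ _ _ _ (bracket_linearl z)).
Definition bracketr z : {linear g -> g} :=
  HB.pack (br z) (GRing.isLinear.Build _ _ _ _ _ (bracket_linearr z)).

Lemma bracketC x y : br x y = - br y x.
Proof.
case: hbr => _ _ brxx _; apply/eqP; rewrite -addr_eq0; apply/eqP.
rewrite -[RHS](brxx (x + y)) -[RHS]/(bracketl _ _) linearD /=.
rewrite -[br x (x + y)]/(bracketr _ _) -[br y (x + y)]/(bracketr _ _) !linearD /=.
by rewrite !brxx add0r addr0.
Qed.

Lemma bracket_coords k x y : coord X k (br x y) =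
  \sum_i \sum_j coord X i x * coord X j y * structure_const i j k.
Proof.
rewrite {1}(coord_basis hX (memvf x)) {1}(coord_basis hX (memvf y)).
rewrite -[br _ _]/(bracketl _ _) !linear_sum; apply: eq_bigr => i _.
rewrite !linearZ /= -[br _ _]/(bracketr _ _) !linear_sum mulr_sumr.
by apply: eq_bigr => j _; rewrite !linearZ /= mulrA.
Qed.

Lemma coord_gmul k x y : coord X k (gmul x y) = coord X k x + coord X k y +
  \sum_(t : {t | t \in Dset br X} | (val t).2 == k)
    (2^-1 * structure_const (val t).1.1 (val t).1.2 (val t).2 *
     (coord X (val t).1.1 x * coord X (val t).1.2 y)).
Proof.
rewrite !linearD /= linearZ /= bracket_coords; congr (_ + _).
pose F (t : 'I_d * 'I_d * 'I_d) := 2^-1 * structure_const t.1.1 t.1.2 t.2 *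
  (coord X t.1.1 x * coord X t.1.2 y).
rewrite -(big_sub_cond _ (fun t : 'I_d * 'I_d * 'I_d => t.2 == k) F) /=.
transitivity (\sum_(t : 'I_d * 'I_d * 'I_d | t.2 == k) F t).
  rewrite pair_big mulr_sumr /=.
  transitivity (\sum_(p : 'I_d * 'I_d) \sum_(l | l == k) F (p, l)).
    by apply: eq_bigr => p _; rewrite big_pred1_eq /F /=; ring.
  by rewrite pair_big_dep; apply: eq_big => -[].
rewrite big_mkcond [RHS]big_mkcond; apply: eq_bigr => t _; rewrite inE /F.
case: (t.2 == k); rewrite ?andbF ?andbT //.
by case: eqP => //= ->; rewrite mulr0 mul0r.
Qed.

Lemma gmulK x : two_step br -> cancel (gmul ^~ x) (gmul^~ (- x)).
Proof.
move=> step2 y; rewrite /Defs.gmul -[br _ (- x)]/(bracketr _ _) linearN /=.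
rewrite -[br (_ + _) x]/(bracketl _ _) !(linearD, linearZ) /=.
rewrite [br (br _ _) _]bracketC step2 !oppr0 !scaler0 addr0.
case: hbr => _ _ -> _; rewrite oppr0 scaler0 addr0 scalerN.
by rewrite addrAC addrK addrK.
Qed.

Lemma right_translation_affine x : linear (fun y => y + 2^-1 *: br y x).
Proof.
move=> a y z; rewrite -![br _ x]/(bracketl _ _) linearP /=.
by rewrite !scalerDr !scalerA addrACA mulrC.
Qed.

Lemma schwartz_right_translation x f : two_step br -> schwartz f ->
  schwartz (fun y => f (gmul y x)).
Proof.
move=> step2 sf.
apply: (@schwartz_affine _ _ _ _ hX (gmul^~ x) (gmul^~ (- x)) _ _ x (- x) f
  (right_translation_affine x) (right_translation_affine (- x))) => //.
- by move=> y; rewrite /Defs.gmul addrAC.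
- by move=> y; rewrite /Defs.gmul addrAC.
- exact: gmulK.
Qed.

Lemma schwartz_opp f : schwartz f -> schwartz (fun x => f (- x)).
Proof.
have lN : linear (@GRing.opp g).
  by move=> a y z; rewrite opprD scalerN.
apply: (@schwartz_affine _ _ _ _ hX -%R -%R _ _ 0 0 f lN lN) => [x|x|].
- by rewrite addr0.
- by rewrite addr0.
- exact: opprK.
Qed.

Variable A : (g -> R[i]) -> R[i].
Hypotheses (step2 : two_step br) (hA : convolver br X A).

(** This is the convolution on the left of [f] with the reflection of the
    distribution [T^b A], the function that [dist_conv] hands over to its second
    factor. *)
Definition tilde_conv (b : multiindex d) f x :=
  A (Tfun X b (fun y => f (gmul y x))).

(** Inversion exchanges [x y^-1] and [y x^-1], so the convolution with the
    reflection of [A] on the left is that with [A] on the right between two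
    reflections of functions. *)
Lemma schwartz_tilde_conv0 f : schwartz f -> schwartz (tilde_conv 0 f).
Proof.
move=> sf; case: hA => _ /(_ _ (schwartz_opp sf)) /schwartz_opp + _.
congr schwartz; apply/funext => x; rewrite /tilde_conv /fun_conv_dist /=.
congr A; rewrite Tfun0; apply/funext => y; congr f.
rewrite /Defs.gmul /ginv !opprD !opprK [y + x]addrC; congr (_ + _).
rewrite -scalerN [br y x]bracketC; congr (_ *: - _).
rewrite -[br (- x) _]/(bracketl _ _) linearN /= -[br x _]/(bracketr _ _) linearN.
exact: opprK.
Qed.

(** Coordinate form of [y = (y x) x^-1]: each [y_i] is affine in the [x_k], with
    coefficients that depend on [y x] only. *)
Lemma coord_mul_right_translation i f x y :
  (coord X i y)%:C * f (gmul y x) =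
  (coord X i (gmul y x))%:C * f (gmul y x) +
  \sum_k (coord X k x)%:C *
    ((- ((i == k)%:R + 2^-1 * coord X i (br (gmul y x) X`_k)))%:C * f (gmul y x)).
Proof.
have -> : coord X i y = coord X i (gmul y x) +
  \sum_k coord X k x * (- ((i == k)%:R + 2^-1 * coord X i (br (gmul y x) X`_k))).
  rewrite -{1}(gmulK x step2 y) {1}/Defs.gmul !linearD /= -addrA; congr (_ + _).
  transitivity (- \sum_k coord X k x *
      ((i == k)%:R + 2^-1 * coord X i (br (gmul y x) X`_k))); last first.
    by rewrite -sumrN; apply: eq_bigr => k _; rewrite mulrN.
  rewrite linearN -[br _ (- x)]/(bracketr _ _) linearN /= scalerN linearN -opprD.
  congr (- _); under eq_bigr do rewrite mulrDr.
  rewrite big_split /=; congr (_ + _).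
    rewrite (bigD1 i)//= eqxx mulr1 big1 ?addr0// => k ki.
    by rewrite eq_sym (negbTE ki) mulr0.
  rewrite linearZ /= {2}(coord_basis hX (memvf x)) -[br _ (\sum__ _)]/(bracketr _ _).
  rewrite !linear_sum mulr_sumr; apply: eq_bigr => k _.
  by rewrite !linearZ /= mulrCA.
rewrite rmorphD /= mulrDl rmorph_sum /= mulr_suml; congr (_ + _).
by apply: eq_bigr => k _; rewrite rmorphM /= mulrA.
Qed.

Lemma schwartz_tilde_conv b f : schwartz f -> schwartz (tilde_conv b f).
Proof.
have tA : tempered X A by case: hA.
elim/multiindex_ind: b f => [|i b IH] f sf; first exact: schwartz_tilde_conv0.
pose F k z := (- ((i == k)%:R + 2^-1 * coord X i (br z X`_k)))%:C * f z.
have sF k : schwartz (F k).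
  have sc : scalar (fun z => - (2^-1 * coord X i (br z X`_k))).
    move=> a y z; rewrite -![br _ X`_k]/(bracketl _ _) linearP linearP /=; ring.
  have := schwartz_lin (- (i == k)%:R)%:C sf (schwartz_linear_form hX sc sf).
  by congr schwartz; apply/funext => z; rewrite /F -mulrDl -rmorphD opprD.
have sT h x : schwartz h -> schwartz (Tfun X b (fun y => h (gmul y x))).
  by move=> sh; apply: schwartz_Tfun => //; exact: schwartz_right_translation.
have E x : tilde_conv (unit_index i + b) f x =
    \sum_k (coord X k x)%:C * tilde_conv b (F k) x +
    tilde_conv b (fun z => (coord X i z)%:C * f z) x.
  rewrite /tilde_conv -(tempered_sum tA)//; last by move=> k; exact: sT.
  rewrite [RHS]addrC -[X in _ = X + _]mul1r -(tempered_lin tA).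
  - rewrite Tfun_unit_index; congr A; apply/funext => y.
    rewrite /Tfun mul1r coord_mul_right_translation mulrDr mulr_sumr.
    by congr (_ + _); apply: eq_bigr => k _; rewrite mulrCA.
  - by apply: (sT (fun z => (coord X i z)%:C * f z)); exact: schwartz_coord.
  - by apply: schwartz_sum => k; exact: sT.
have := schwartz_lin 1 (schwartz_sum (index_enum _) (fun=> 1)
  (fun k => schwartz_coord hX k (IH _ (sF k)))) (IH _ (schwartz_coord hX i sf)).
congr schwartz; apply/funext => x; rewrite E mul1r; congr (_ + _).
by apply: eq_bigr => k _; rewrite mul1r.
Qed.

End LieProduct.

(** * Monomials in the coordinates of a product *)

Section MonomialOfProduct.
Set Implicit Arguments.
Unset Strict Implicit.
Variables (R : realType) (g : vectType R) (br : g -> g -> g).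
Variables (d : nat) (X : d.-tuple g).
Hypotheses (hbr : is_lie_bracket br) (hX : basis_of fullv X).
Implicit Types (x y : g).
Local Notation D := {t | t \in Dset br X}.
Local Notation summand := ('I_d + 'I_d + D)%type.

(** A [summand] names a term of the expansion of some coordinate of [x y]: a
    coordinate of [x], one of [y], or a term of the bracket. *)
Definition summand_coord (s : summand) : 'I_d :=
  match s with inl (inl k) => k | inl (inr k) => k | inr t => (val t).2 end.

Definition summand_value x y (s : summand) : R :=
  match s with
  | inl (inl k) => coord X k x
  | inl (inr k) => coord X k y
  | inr t => 2^-1 * structure_const br X (val t).1.1 (val t).1.2 (val t).2 *
             (coord X (val t).1.1 x * coord X (val t).1.2 y)
  end.

Lemma sum_summand_value k x y :
  \sum_(s | summand_coord s == k) summand_value x y s = coord X k (gmul br x y).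
Proof. by rewrite !big_sumType /= !big_pred1_eq coord_gmul. Qed.

(** The triples [(beta, gamma, sigma)] are the multidegrees in the summands. *)
Definition merge_index (p : multiindex d * multiindex d * {ffun D -> nat}) :
    {ffun summand -> nat} :=
  [ffun s => match s with
             | inl (inl k) => p.1.1 k | inl (inr k) => p.1.2 k | inr t => p.2 t end].

Lemma push_merge_index p :
  push summand_coord (merge_index p) = p.1.1 + p.1.2 + sigma0 p.2.
Proof.
apply/ffunP => k; rewrite !ffunE !big_sumType /= !big_pred1_eq !ffunE.
by congr (_ + _)%N; apply: eq_bigr => t _; rewrite ffunE.
Qed.

Lemma merge_index_bij alpha :
  set_bij (index_set br X alpha) (fiber summand_coord alpha) merge_index.
Proof.
split=> [p pa|p q _ _ /ffunP E|t ta].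
- by rewrite /fiber /= push_merge_index.
- case: p q E => [[p1 p2] p3] [[q1 q2] q3] E; congr (_, _, _); apply/ffunP => k.
  + by have := E (inl (inl k)); rewrite !ffunE.
  + by have := E (inl (inr k)); rewrite !ffunE.
  + by have := E (inr k); rewrite !ffunE.
- pose p : multiindex d * multiindex d * {ffun D -> nat} :=
    ([ffun k => t (inl (inl k))], [ffun k => t (inl (inr k))], [ffun k => t (inr k)]).
  have pt : merge_index p = t by apply/ffunP => -[[k|k]|k]; rewrite !ffunE.
  by exists p => //; move: ta; rewrite -pt /fiber /= push_merge_index.
Qed.

Lemma prod_exp_fiber (T : finType) (f : T -> 'I_d) (c : 'I_d -> R) (s : T -> nat) :
  \prod_t c (f t) ^+ s t = \prod_k c k ^+ (\sum_(t | f t == k) s t)%N.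
Proof.
rewrite (partition_big f xpredT)//=; apply: eq_bigr => k _.
by rewrite -prodrXr; apply: eq_bigr => t /eqP->.
Qed.

Lemma egf_term_merge_index alpha p x y : index_set br X alpha p ->
  (mfact alpha)%:R * egf_term (summand_value x y) (merge_index p) =
  mbinom alpha p.1.1 p.2 * csigma p.2 *
  (\prod_k coord X k x ^+ (p.1.1 + sigma1 p.2)%R k *
   \prod_k coord X k y ^+ (p.1.2 + sigma2 p.2)%R k).
Proof.
case: p => [[b c] s] /= E.
(* on the index set the truncated differences in [mbinom] are the exponents of
   [gamma], here [c] *)
have -> : mbinom alpha b s =
    (mfact alpha)%:R / ((mfact b * mfact s * mfact c)%N%:R : R).
  congr (_ / (_ * _)%N%:R); apply: eq_bigr => k _; rewrite ffunE; congr (_`!).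
  have -> : alpha k = (b k + c k + sigma0 s k)%N by rewrite -E !ffunE.
  by rewrite -addnA addKn addnK.
have prodV (T : finType) (u : {ffun T -> nat}) (v : T -> R) :
    \prod_t (v t ^+ u t / (u t)`!%:R) = \prod_t v t ^+ u t / (mfact u)%:R.
  by rewrite /mfact natr_prod -prodfV -big_split.
have pD (c1 c2 : multiindex d) (v : 'I_d -> R) :
    \prod_k v k ^+ (c1 + c2)%R k = \prod_k v k ^+ c1 k * \prod_k v k ^+ c2 k.
  by rewrite -big_split; apply: eq_bigr => k _; rewrite ffunE exprD.
rewrite /egf_term !big_sumType /=; under eq_bigr do rewrite ffunE /=.
under [X in _ * X * _]eq_bigr do rewrite ffunE /=.
under [X in _ * _ * X]eq_bigr do rewrite ffunE /=.
rewrite !prodV !pD !natrM !invfM.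
have -> : \prod_(t : D)
      (2^-1 * structure_const br X (val t).1.1 (val t).1.2 (val t).2 *
       (coord X (val t).1.1 x * coord X (val t).1.2 y)) ^+ s t =
    csigma s *
      (\prod_k coord X k x ^+ sigma1 s k * \prod_k coord X k y ^+ sigma2 s k).
  under [LHS]eq_bigr do rewrite !exprMn.
  rewrite !big_split /= /csigma prodrXr exprVn; congr (_ * (_ * _)).
  - by under [RHS]eq_bigr do rewrite ffunE; rewrite -prod_exp_fiber.
  - by under [RHS]eq_bigr do rewrite ffunE; rewrite -prod_exp_fiber.
ring.
Qed.

Lemma monomial_gmul (alpha : multiindex d) x y :
  \prod_k coord X k (gmul br x y) ^+ alpha k =
  \sum_(p \in index_set br X alpha) (mbinom alpha p.1.1 p.2 * csigma p.2 *
    (\prod_k coord X k x ^+ (p.1.1 + sigma1 p.2)%R k *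
     \prod_k coord X k y ^+ (p.1.2 + sigma2 p.2)%R k)).
Proof.
under eq_bigr do rewrite -sum_summand_value.
rewrite multinomial mulr_fsumr (reindex_fsbig _ _ _ _ (merge_index_bij alpha)).
by apply: eq_fsbigr => p /set_mem pa; exact: egf_term_merge_index.
Qed.

End MonomialOfProduct.

Theorem corollary3p14 (R : realType) (g : vectType R) (br : g -> g -> g)
    (delta : R -> g -> g) (d : nat) (X : d.-tuple g)
    (hbr : is_lie_bracket br) (hstep : two_step br)
    (hdelta : is_dilation_group br delta) (hexp : exponents_one_two delta)
    (hX : basis_of fullv X)
    (A B : (g -> R[i]) -> R[i])
    (hA : convolver br X A) (hB : convolver br X B)
    (alpha : multiindex d) :
  dist_eq X (Tdist X alpha (dist_conv br A B))
    (fun f => \sum_(p \in index_set br X alpha)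
       (mbinom alpha p.1.1 p.2 * csigma p.2)%:C *
       dist_conv br (Tdist X (p.1.1 + sigma1 p.2) A)
                    (Tdist X (p.1.2 + sigma2 p.2) B) f).
Proof.
move=> f sf.
have tA : tempered X A by case: hA.
have tB : tempered X B by case: hB.
rewrite fsbig_finite /=; last exact: finite_index_set.
set r := fset_set _.
pose ix : Type :=
  (multiindex d * multiindex d * {ffun {t | t \in Dset br X} -> nat})%type.
pose C (p : ix) : R[i] := (mbinom alpha p.1.1 p.2 * csigma p.2)%:C.
pose G (p : ix) :=
  Tfun X (p.1.2 + sigma2 p.2) (tilde_conv br X A (p.1.1 + sigma1 p.2) f).
have convE (b c : multiindex d) : dist_conv br (Tdist X b A) (Tdist X c B) f =
    B (Tfun X c (tilde_conv br X A b f)).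
  rewrite /dist_conv /Tdist; congr (B (Tfun _ _ _)); apply/funext => x.
  rewrite /dist_conv_fun /dist_tilde /tilde_conv; congr (A (Tfun _ _ _)).
  by apply/funext => y; rewrite /ginv opprK.
under eq_bigr do rewrite convE.
rewrite -(tempered_sum tB _ C (F := G)); last first.
  by move=> p; apply: schwartz_Tfun => //; exact: schwartz_tilde_conv.
rewrite /Tdist /dist_conv; congr B; apply/funext => x.
rewrite /dist_conv_fun /dist_tilde.
pose H (p : ix) := Tfun X (p.1.1 + sigma1 p.2) (fun y => f (gmul br y x)).
pose m (p : ix) : R[i] :=
  (\prod_(i < d) coord X i x ^+ (p.1.2 + sigma2 p.2)%R i)%:C.
transitivity (A (fun y => \sum_(p <- r) (C p * m p) * H p y)).
  congr A; apply/funext => y; rewrite /ginv opprK /Tfun monomial_gmul//.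
  rewrite fsbig_finite; last exact: finite_index_set.
  rewrite rmorph_sum mulr_suml; apply: eq_bigr => p _.
  by rewrite /H /C /m /Tfun !rmorphM /= !mulrA; congr (_ * _); rewrite mulrAC.
rewrite (tempered_sum tA); last first.
  by move=> p; apply: schwartz_Tfun => //; exact: schwartz_right_translation.
by apply: eq_bigr => p _; rewrite mulrA.
Qed.
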